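(* Suppose that $\Phi,\Phi'\colon\mathcal{P}\to\mathcal{P}$ are support-preserving and multiplicative, and that $p\in\mathcal{P}$ is a polynomial with at least two terms (i.e. at least two nonzero coefficients). Then $\Phi[p]=\Phi'[p]$ implies $\Phi=\Phi'$.
   Context: $\mathcal{P}$ is the set of real polynomials $p(x)=\sum_{k=0}^n p_kx^k$ in one variable (of arbitrary degree) with $p_k\geq 0$ for all $k$ and $p(1)=1$. A map $\Phi\colon\mathcal{P}\to\mathcal{P}$ is support-preserving if for every $p\in\mathcal{P}$ and every $k$, writing $p'=\Phi[p]$, one has $p'_k>0$ if and only if $p_k>0$. It is multiplicative if $\Phi[p\cdot q]=\Phi[p]\cdot\Phi[q]$ for all $p,q\in\mathcal{P}$. *)

(* Defs.v *)
From HB Require Import structures.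
From mathcomp Require Import all_boot all_order all_algebra.
From mathcomp Require Import reals.

Set Implicit Arguments.
Unset Strict Implicit.
Unset Printing Implicit Defensive.

Import Order.TTheory GRing.Theory Num.Theory.
Local Open Scope ring_scope.

Definition is_prob_poly (R : realType) : pred {poly R} :=
  fun p => (p \is a polyOver Num.nneg) && (p.[1] == 1).

Record prob_poly (R : realType) := ProbPoly {
  prob_poly_val :> {poly R};
  prob_polyP : is_prob_poly prob_poly_val }.

HB.instance Definition _ (R : realType) := [isSub for @prob_poly_val R].
HB.instance Definition _ (R : realType) := [Choice of prob_poly R by <:].

Lemma prob_poly_mul_subproof (R : realType) (p q : prob_poly R) :
  is_prob_poly (val p * val q).
Proof.
case: p q => [p /andP[p0 /eqP p1]] [q /andP[q0 /eqP q1]] /=.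
rewrite /is_prob_poly hornerM p1 q1 mulr1 eqxx andbT.
apply/polyOverP => k; rewrite coefM nnegrE sumr_ge0 // => i _.
by rewrite mulr_ge0 // -nnegrE; [apply: (polyOverP p0) | apply: (polyOverP q0)].
Qed.

Definition prob_poly_mul (R : realType) (p q : prob_poly R) : prob_poly R :=
  ProbPoly (prob_poly_mul_subproof p q).

Definition support_preserving (R : realType)
    (Phi : prob_poly R -> prob_poly R) : Prop :=
  forall (p : prob_poly R) (k : nat), 0 < (val (Phi p))`_k <-> 0 < (val p)`_k.

Definition multiplicative_map (R : realType)
    (Phi : prob_poly R -> prob_poly R) : Prop :=
  forall p q : prob_poly R,
    Phi (prob_poly_mul p q) = prob_poly_mul (Phi p) (Phi q).

(* The entries of a polynomial, as a sequence, are its coefficients. *)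
Definition nb_terms (R : realType) (p : {poly R}) : nat :=
  count (fun c => c != 0) p.

(* Main.v *)
(* A support-preserving multiplicative map is an exponential tilting
   p(x) |-> p(c x) / p(c), and c can be read off the image of any polynomial
   with two terms.
   Rescale to polynomials with nonnegative coefficients and constant term 1.
   If P and Q agree up to degree k, there is a multiplier h (a truncated inverse
   of P plus a large multiple of x^(k+1) (1 + ... + x^d)) such that h P and h Q
   are nonnegative and equal 1 up to degree k; support preservation keeps the
   gaps, so phi(h P) phi(Q) = phi(h Q) phi(P) shows that phi(P) and phi(Q) agree
   up to degree k. As P agrees up to degree k with
   (P truncated below k) (1 + P_k x^k), the k-th coefficient of phi(P) depends
   only on P_k. For k = 1 this dependence is additive and positive, hence
   P_1 |-> c P_1; comparison with (1 + x) (1 + P_k x^(k-1)) gives c^k P_k. *)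
Require Import Defs.
From HB Require Import structures.
From mathcomp Require Import all_boot all_order all_algebra.
From mathcomp Require Import boolp reals ring.

Set Implicit Arguments.
Unset Strict Implicit.
Unset Printing Implicit Defensive.

Import Order.TTheory GRing.Theory Num.Theory.
Local Open Scope ring_scope.

(** * Positive additive functions on the half-line *)

(** Positivity makes [f] monotone, so comparison at integers bounds [n |f a - f 1 * a|] by [f 1] for
    every [n]; the Archimedean property concludes. *)
Lemma additive_pos_linear (R : archiRealFieldType) (f : R -> R) :
  (forall a, 0 <= a -> 0 <= f a) ->
  (forall a b, 0 <= a -> 0 <= b -> f (a + b) = f a + f b) ->
  forall a, 0 <= a -> f a = f 1 * a.
Proof.
move=> f_ge0 fD a a_ge0.
have fMn n b : 0 <= b -> f (b *+ n) = f b *+ n.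
  move=> b_ge0; elim: n => [|n IHn].
    by rewrite !mulr0n; apply: (addrI (f 0)); rewrite -fD // !addr0.
  by rewrite !mulrS fD ?IHn // mulrn_wge0.
have f_mono b d : 0 <= b -> b <= d -> f b <= f d.
  move=> b_ge0 le_bd; rewrite -(subrK b d) fD ?subr_ge0 // lerDr.
  by apply: f_ge0; rewrite subr_ge0.
have close n : `|f a - f 1 * a| *+ n <= f 1.
  have na_ge0 : 0 <= a *+ n by rewrite mulrn_wge0.
  have /andP[le_m lt_m] := truncn_itv na_ge0.
  (* Both [n f(a)] and [n a f(1)] lie between [m f(1)] and [(m+1) f(1)]. *)
  set m := Num.truncn (a *+ n) in le_m lt_m.
  have := f_mono _ _ (ler0n R m) le_m; have := f_mono _ _ na_ge0 (ltW lt_m).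
  rewrite !fMn // => fa_le fa_ge.
  rewrite -normrMn mulrnBl -mulrnAr ler_distl lerBlDr; apply/andP; split.
    apply: le_trans (_ : f 1 * m.+1%:R <= _).
      by rewrite ler_wpM2l ?f_ge0 // ltW.
    by rewrite mulr_natr mulrSr lerD2r.
  apply: le_trans fa_le _.
  by rewrite mulrSr lerD2r -[f 1 *+ m]mulr_natr ler_wpM2l ?f_ge0.
apply/eqP; rewrite -subr_eq0 -normr_le0 leNgt; apply/negP => d_gt0.
have /andP[_] := truncn_itv (divr_ge0 (f_ge0 _ ler01) (ltW d_gt0)).
by rewrite ltr_pdivrMr // mulr_natl ltNge close.
Qed.

(** * Agreement up to a degree and common multipliers *)

Definition eq_upto (R : nzRingType) (k : nat) (P Q : {poly R}) :=
  forall i, (i <= k)%N -> P`_i = Q`_i.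

Lemma eq_uptoM (R : nzRingType) k (P P' Q Q' : {poly R}) :
  eq_upto k P P' -> eq_upto k Q Q' -> eq_upto k (P * Q) (P' * Q').
Proof.
move=> eqP eqQ i le_ik; rewrite !coefM; apply: eq_bigr => j _.
rewrite eqP ?eqQ // ?(leq_trans (leq_subr _ _)) //.
by rewrite (leq_trans _ le_ik) // -ltnS.
Qed.

(** Since [P] has constant term 1, subtracting a multiple of [X^(k+1)] from [U] corrects the
    coefficient of degree [k+1] and leaves the lower ones unchanged. *)
Lemma trunc_inverse (R : comNzRingType) (P : {poly R}) k :
  P`_0 = 1 -> exists U, eq_upto k (U * P) 1.
Proof.
move=> P0; elim: k => [|k [U HU]].
  by exists 1 => i; rewrite leqn0 mul1r => /eqP->; rewrite P0 coef1.
exists (U - (U * P)`_k.+1 *: 'X^(k.+1)) => i le_ik.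
rewrite mulrBl -scalerAl coefB coefZ coefXnM.
move: le_ik; rewrite leq_eqVlt => /predU1P[->|lt_ik].
  by rewrite ltnn subnn P0 mulr1 subrr coef1.
by rewrite lt_ik mulr0 subr0 HU.
Qed.

(** Unlike the value at 1, the constant term survives truncation, so coefficients can be studied
    degree by degree. *)
Definition normalized (R : realType) (P : {poly R}) :=
  (forall i, 0 <= P`_i) /\ P`_0 = 1.

Lemma normalizedM (R : realType) (P Q : {poly R}) :
  normalized P -> normalized Q -> normalized (P * Q).
Proof.
move=> [P_ge0 P0] [Q_ge0 Q0]; split=> [i|]; last by rewrite coef0M P0 Q0 mulr1.
by rewrite coefM sumr_ge0 // => j _; rewrite mulr_ge0.
Qed.

Lemma normalized1DXn (R : realType) (a : R) k :
  (0 < k)%N -> 0 <= a -> normalized (1 + a *: 'X^k).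
Proof.
move=> k_gt0 a_ge0; split=> [i|].
  rewrite coefD coefZ coefXn coef1 addr_ge0 ?ler0n //.
  by rewrite mulr_ge0 ?ler0n.
by case: k k_gt0 => // k _; rewrite coefD coefZ coefXn coef1 mulr0 addr0.
Qed.

Lemma normalized_take (R : realType) (P : {poly R}) k :
  (0 < k)%N -> normalized P -> normalized (take_poly k P).
Proof.
by move=> k_gt0 [P_ge0 P0]; split=> [i|]; rewrite coef_take_poly ?k_gt0 //; case: ifP.
Qed.

(* The block [T x^(k+1) (1 + ... + x^(d-1))] dominates the finitely many,
   possibly negative, coefficients of [U P] beyond degree [k], because
   [P] has constant term 1. *)
Lemma normalized_dominated (R : realType) (P U : {poly R}) k d (T : R) :
  normalized P -> eq_upto k (U * P) 1 -> (size (U * P)%R <= d)%N ->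
  (forall i, `|(U * P)`_i| <= T) ->
  let h := U + T *: ('X^(k.+1) * \poly_(i < d) 1) in
  normalized (h * P) /\ eq_upto k (h * P) 1.
Proof.
move=> [P_ge0 P0] UP1 size_d le_T h.
have T_ge0 : 0 <= T by apply: le_trans (le_T 0%N); rewrite normr_ge0.
have hPE i : (h * P)`_i = (U * P)`_i +
    T * (if (i < k.+1)%N then 0 else (\poly_(i < d) 1 * P)`_(i - k.+1)).
  by rewrite mulrDl -scalerAl -mulrA coefD coefZ coefXnM.
have hP1 : eq_upto k (h * P) 1.
  by move=> i le_ik; rewrite hPE ltnS le_ik mulr0 addr0 UP1.
split=> //; split=> [i|]; last by rewrite hP1 // coef1.
have [le_ik|lt_ki] := leqP i k; first by rewrite hP1 // coef1 ler0n.
rewrite hPE ltnNge lt_ki /=.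
have EP_ge j : (j < d)%:R <= (\poly_(i < d) 1 * P)`_j.
  rewrite coefM big_ord_recr /= subnn P0 mulr1 coef_poly.
  rewrite -[X in X <= _]add0r lerD //; last by case: ifP.
  by apply: sumr_ge0 => l _; rewrite coef_poly mulr_ge0 //; case: ifP.
have [lt_id|le_di] := ltnP i d; last first.
  rewrite (nth_default _ (leq_trans size_d le_di)) add0r mulr_ge0 //.
  exact: le_trans (EP_ge _).
have lt_d : (i - k.+1 < d)%N := leq_ltn_trans (leq_subr _ _) lt_id.
have := EP_ge (i - k.+1)%N; rewrite lt_d => /(ler_wpM2l T_ge0).
rewrite mulr1 => le_TE.
rewrite addrC -lerBlDr sub0r; apply: le_trans le_TE.
by apply: le_trans (le_T i); rewrite -normrN ler_norm.
Qed.

Lemma coef_le_sum_norm (R : realType) (P : {poly R}) i :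
  `|P`_i| <= \sum_(j < size P) `|P`_j|.
Proof.
have [lt_i|le_i] := ltnP i (size P); last first.
  by rewrite nth_default // normr0 sumr_ge0.
by rewrite (bigD1 (Ordinal lt_i)) //= lerDl sumr_ge0.
Qed.

Lemma common_multiplier (R : realType) (P Q : {poly R}) k :
  normalized P -> normalized Q -> eq_upto k P Q ->
  exists h, [/\ normalized (h * P), normalized (h * Q),
    eq_upto k (h * P) 1 & eq_upto k (h * Q) 1].
Proof.
move=> nP nQ eqPQ; have [U UP1] := trunc_inverse k nP.2.
have UQ1 : eq_upto k (U * Q) 1.
  by move=> i le_ik; rewrite -UP1 // -(@eq_uptoM _ k U U P Q).
(* The block length and height are chosen to suit both [U * P] and [U * Q], so that a single [h]
   serves both. *)
pose d := maxn (size (U * P)) (size (U * Q)).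
pose S (P : {poly R}) := \sum_(j < size (U * P)) `|(U * P)`_j|.
have S_ge0 V : 0 <= S V by rewrite sumr_ge0.
have [|i|nhP hP1] := @normalized_dominated _ _ _ k d (S P + S Q) nP UP1.
- by rewrite leq_maxl.
- by apply: le_trans (coef_le_sum_norm _ _) _; rewrite lerDl.
have [|i|nhQ hQ1] := @normalized_dominated _ _ _ k d (S P + S Q) nQ UQ1.
- by rewrite leq_maxr.
- by apply: le_trans (coef_le_sum_norm _ _) _; rewrite lerDr.
by eexists; split; [exact: nhP|exact: nhQ|exact: hP1|exact: hQ1].
Qed.

(** * Support-preserving multiplicative maps on normalized polynomials *)

(** Values outside normalized polynomials are unconstrained, which avoids a subtype. As coefficients
    are nonnegative, the vanishing condition is support preservation. *)
Record supp_morphism (R : realType) (phi : {poly R} -> {poly R}) : Prop := {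
  supp_morph_norm P : normalized P -> normalized (phi P);
  supp_morphM P Q : normalized P -> normalized Q -> phi (P * Q) = phi P * phi Q;
  supp_morph_eq0 P k : normalized P -> (phi P)`_k = 0 <-> P`_k = 0 }.

Lemma supp_morph_eq_upto1 (R : realType) (phi : {poly R} -> {poly R}) P k :
  supp_morphism phi -> normalized P -> eq_upto k P 1 -> eq_upto k (phi P) 1.
Proof.
move=> phiP nP P1 [|i] le_ik; first by rewrite (supp_morph_norm phiP nP).2 coef1.
by rewrite coef1; apply/(supp_morph_eq0 phiP _ nP); rewrite P1 // coef1.
Qed.

Lemma supp_morph_eq_upto (R : realType) (phi : {poly R} -> {poly R}) P Q k :
  supp_morphism phi -> normalized P -> normalized Q -> eq_upto k P Q ->
  eq_upto k (phi P) (phi Q).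
Proof.
move=> phiP nP nQ eqPQ i le_ik.
have [h [nhP nhQ hP1 hQ1]] := common_multiplier nP nQ eqPQ.
(* Both sides are the image of [h * P * Q]. *)
have E : phi (h * P) * phi Q = phi (h * Q) * phi P.
  by rewrite -!supp_morphM // mulrAC.
have one (V W : {poly R}) : eq_upto k V 1 -> (V * W)`_i = W`_i.
  by move=> V1; rewrite (@eq_uptoM _ k V 1 W W) // mul1r.
by rewrite -(one (phi (h * Q)) (phi P)) -?E ?one //; apply: supp_morph_eq_upto1.
Qed.

Lemma coefM_gap (R : realType) (P Q : {poly R}) k :
  (0 < k)%N -> P`_0 = 1 -> Q`_0 = 1 ->
  (forall i, (0 < i < k)%N -> Q`_i = 0) -> (P * Q)`_k = P`_k + Q`_k.
Proof.
case: k => // k _ P0 Q0 Q_gap.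
rewrite coefM big_ord_recl big_ord_recr /= subn0 P0 mul1r big1 ?add0r.
  by rewrite /bump /= add1n subnn Q0 mulr1 addrC.
move=> i _; rewrite /bump /= add1n subSS Q_gap ?mulr0 // subn_gt0 ltn_ord /=.
by rewrite ltnS leq_subr.
Qed.

Lemma supp_morph_coef1DXn (R : realType) (phi : {poly R} -> {poly R}) P k :
  supp_morphism phi -> (0 < k)%N -> normalized P ->
  (phi P)`_k = (phi (1 + P`_k *: 'X^k))`_k.
Proof.
move=> phiP k_gt0 nP.
have nT := normalized_take k_gt0 nP.
have nB : normalized (1 + P`_k *: 'X^k) by apply: normalized1DXn => //; apply: nP.1.
(* The second factor affects the truncation only from degree [k] on, where it restores the missing
   coefficient. *)
have eqP : eq_upto k P (take_poly k P * (1 + P`_k *: 'X^k)).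
  move=> i le_ik; rewrite mulrDr mulr1 -scalerAr coefD coefZ coefMXn coef_take_poly.
  move: le_ik; rewrite leq_eqVlt => /predU1P[->|->]; last by rewrite mulr0 addr0.
  by rewrite ltnn subnn nT.2 mulr1 add0r.
rewrite (supp_morph_eq_upto phiP nP (normalizedM nT nB) eqP) // supp_morphM //.
rewrite coefM_gap ?(supp_morph_norm phiP nT).2 ?(supp_morph_norm phiP nB).2 //.
  rewrite (_ : (phi (take_poly k P))`_k = 0) ?add0r //.
  by apply/(supp_morph_eq0 phiP _ nT); rewrite coef_take_poly ltnn.
move=> i /andP[i_gt0 lt_ik]; apply/(supp_morph_eq0 phiP _ nB).
by rewrite coefD coef1 coefZ coefXn gtn_eqF // ltn_eqF // mulr0 addr0.
Qed.

Lemma supp_morph_coef (R : realType) (phi : {poly R} -> {poly R}) :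
  supp_morphism phi ->
  exists2 c, 0 < c & forall P k, normalized P -> (phi P)`_k = c ^+ k * P`_k.
Proof.
move=> phiP.
have nB (a : R) k : 0 <= a -> normalized (1 + a *: 'X^(k.+1)) by apply: normalized1DXn.
have coefB (a : R) k i :
    (1 + a *: 'X^(k.+1))`_i = if i == 0%N then 1 else if i == k.+1 then a else 0.
  rewrite coefD coef1 coefZ coefXn; case: i => [|i] /=; first by rewrite mulr0 addr0.
  by rewrite add0r; case: eqP; rewrite ?mulr1 ?mulr0.
have indep P Q k : normalized P -> normalized Q -> P`_k.+1 = Q`_k.+1 ->
    (phi P)`_k.+1 = (phi Q)`_k.+1.
  by move=> nP nQ eqk; rewrite [LHS]supp_morph_coef1DXn ?eqk -?supp_morph_coef1DXn.
pose f a := (phi (1 + a *: 'X^1))`_1.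
have f_ge0 a : 0 <= a -> 0 <= f a.
  by move=> a_ge0; have [->] := supp_morph_norm phiP (nB _ 0%N a_ge0).
have fD a b : 0 <= a -> 0 <= b -> f (a + b) = f a + f b.
  move=> a_ge0 b_ge0; have [nA nBb] := (nB _ 0%N a_ge0, nB _ 0%N b_ge0).
  have gap1 (P Q : {poly R}) : normalized P -> normalized Q ->
      (P * Q)`_1 = P`_1 + Q`_1.
    by move=> [_ P0] [_ Q0]; apply: coefM_gap => // -[|i] //; rewrite ltnS ltn0 andbF.
  rewrite /f -gap1 -?(supp_morphM phiP nA nBb); try exact: (supp_morph_norm phiP).
  apply: indep; [exact: nB (addr_ge0 _ _)|exact: normalizedM|].
  by rewrite gap1 // !coefB.
have flin := additive_pos_linear f_ge0 fD.
exists (f 1).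
  (* [f 1] is nonzero because [1 + X] has a term of degree 1 and the support is preserved. *)
  rewrite lt_def f_ge0 // andbT; apply/eqP.
  by move/(supp_morph_eq0 phiP _ (nB _ _ ler01)); rewrite coefB => /eqP; rewrite oner_eq0.
move=> P k; elim: k P => [|[|k] IHk] P nP.
- by rewrite (supp_morph_norm phiP nP).2 nP.2 mulr1.
- by rewrite (supp_morph_coef1DXn phiP) // -/(f _) flin // nP.1.
set a := P`_k.+2; have a_ge0 : 0 <= a := nP.1 _.
have [nX nA] := (nB _ 0%N ler01, nB _ k a_ge0).
have coefXA (V W : {poly R}) : (forall i, (1 < i)%N -> V`_i = 0) -> V`_0 = 1 ->
    W`_k.+2 = 0 -> (V * W)`_k.+2 = V`_1 * W`_k.+1.
  move=> V0 V1 W0; rewrite coefM big_ord_recl /= W0 mulr0 add0r big_ord_recl /=.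
  by rewrite big1 ?addr0 ?subSS ?subn0 // => i _; rewrite V0 ?mul0r.
(* In degree [k+2] this product has coefficient [a]. Its image has there the product of the
   coefficients of degrees 1 and [k+1], that is [c * (c^(k+1) * a)]. *)
rewrite (@indep P ((1 + 1 *: 'X^1) * (1 + a *: 'X^(k.+1)))) //.
- rewrite supp_morphM // coefXA -/(f 1) ?(supp_morph_norm phiP nX).2 //.
  + by rewrite IHk // coefB eqxx /= mulrA -exprS.
  + move=> i i_gt1; apply/(supp_morph_eq0 phiP _ nX).
    by rewrite coefB; case: i i_gt1 => [|[]].
  + by apply/(supp_morph_eq0 phiP _ nA); rewrite coefB /= gtn_eqF.
- exact: normalizedM.
- rewrite coefXA ?coefB /= ?eqxx ?mul1r ?gtn_eqF //.
  by case=> [|[|i]] // _; rewrite coefB.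
Qed.

(** * Passage between probability polynomials and normalized ones *)

Lemma is_prob_polyP (R : realType) (p : {poly R}) :
  reflect ((forall i, 0 <= p`_i) /\ p.[1] = 1) (is_prob_poly p).
Proof.
apply: (iffP andP) => -[].
  by move=> /polyOverP p_ge0 /eqP.
by move=> p_ge0 /eqP; split=> //; apply/polyOverP.
Qed.

Lemma prob_poly_ge0 (R : realType) (p : prob_poly R) i : 0 <= (val p)`_i.
Proof. by have /is_prob_polyP[] := prob_polyP p. Qed.

Lemma prob_poly_horner1 (R : realType) (p : prob_poly R) : (val p).[1] = 1.
Proof. by have /is_prob_polyP[] := prob_polyP p. Qed.

Lemma is_prob_polyXn (R : realType) m : is_prob_poly ('X^m : {poly R}).
Proof.
apply/is_prob_polyP; split=> [i|]; first by rewrite coefXn ler0n.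
by rewrite hornerXn expr1n.
Qed.

Definition prob_Xn (R : realType) m : prob_poly R := ProbPoly (is_prob_polyXn R m).

(** The default, the constant 1, is never reached on normalized input. *)
Definition rescale (R : realType) (P : {poly R}) : prob_poly R :=
  insubd (prob_Xn R 0) (P.[1]^-1 *: P).

Lemma normalized_horner1_gt0 (R : realType) (P : {poly R}) :
  normalized P -> 0 < P.[1].
Proof.
move=> [P_ge0 P0]; rewrite horner_coef.
have : (0 < size P)%N.
  by rewrite size_poly_gt0; apply/eqP => P_eq0; move/eqP: P0;
     rewrite P_eq0 coef0 eq_sym oner_eq0.
case: (size P) => // n _; rewrite big_ord_recl P0 expr0 mulr1.
by rewrite ltr_pwDl // sumr_ge0 // => i _; rewrite expr1n mulr1.
Qed.

Lemma val_rescale (R : realType) (P : {poly R}) :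
  normalized P -> val (rescale P) = P.[1]^-1 *: P.
Proof.
move=> nP; have P1_gt0 := normalized_horner1_gt0 nP.
rewrite insubdK //; apply/is_prob_polyP; split=> [i|].
  by rewrite coefZ mulr_ge0 ?invr_ge0 ?(ltW P1_gt0) //; apply: nP.1.
by rewrite hornerZ mulVf // gt_eqF.
Qed.

Lemma rescaleM (R : realType) (P Q : {poly R}) :
  normalized P -> normalized Q ->
  rescale (P * Q) = prob_poly_mul (rescale P) (rescale Q).
Proof.
move=> nP nQ; apply: val_inj => /=.
rewrite [LHS]val_rescale ?[prob_poly_val (rescale _)]val_rescale //;
  last exact: normalizedM.
by rewrite hornerM invfM -scalerAl -scalerAr scalerA.
Qed.

(** * Tilting form of the maps on probability polynomials *)

Section Tilting.
Context (R : realType) (Phi : prob_poly R -> prob_poly R).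
Hypothesis Phi_supp : support_preserving Phi.
Hypothesis Phi_mul : multiplicative_map Phi.

Lemma supp_preserving_eq0 p k : (val (Phi p))`_k = 0 <-> (val p)`_k = 0.
Proof.
have := Phi_supp p k; rewrite !lt_def !prob_poly_ge0 !andbT => suppE.
split=> /eqP E; apply/eqP; apply: contraTT E => /suppE //; by move=> ->.
Qed.

(** This is [Phi] transported to normalized polynomials; for those, support preservation makes the
    constant term divided by positive. *)
Definition unscaled (P : {poly R}) : {poly R} :=
  ((val (Phi (rescale P)))`_0)^-1 *: val (Phi (rescale P)).

Lemma unscaled_supp_morphism : supp_morphism unscaled.
Proof.
have coef0_gt0 P : normalized P -> 0 < (val (Phi (rescale P)))`_0.
  move=> nP; apply/Phi_supp; rewrite val_rescale // coefZ nP.2 mulr1.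
  by rewrite invr_gt0 normalized_horner1_gt0.
split=> [P nP|P Q nP nQ|P k nP]; rewrite /unscaled.
- split=> [i|]; last by rewrite coefZ mulVf // gt_eqF // coef0_gt0.
  by rewrite coefZ mulr_ge0 ?invr_ge0 ?prob_poly_ge0.
- by rewrite rescaleM // Phi_mul /= coef0M invfM -scalerAl -scalerAr scalerA.
have zeroZ (a x : R) : 0 < a -> a^-1 * x = 0 <-> x = 0.
  move=> a_gt0; split=> [/eqP|->]; last by rewrite mulr0.
  by rewrite mulf_eq0 invr_eq0 gt_eqF //= => /eqP.
rewrite coefZ zeroZ ?coef0_gt0 // supp_preserving_eq0 val_rescale // coefZ.
by rewrite zeroZ // normalized_horner1_gt0.
Qed.

(** Normalizing by the constant term requires it to be nonzero, so the lowest power of [X] is split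
    off first. *)
Lemma prob_poly_factorXn (p : prob_poly R) :
  exists m (q : prob_poly R), 0 < (val q)`_0 /\ p = prob_poly_mul (prob_Xn R m) q.
Proof.
have ex_m : exists m, (val p)`_m != 0.
  exists (size (val p)).-1; rewrite -lead_coefE lead_coef_eq0.
  apply/eqP => p0; have := prob_poly_horner1 p; rewrite p0 horner0 => /eqP.
  by rewrite eq_sym oner_eq0.
case: (ex_minnP ex_m) => m pm_neq0 m_min.
have pE : 'X^m * drop_poly m (val p) = val p.
  rewrite -[RHS](poly_take_drop m) commr_polyXn -[LHS]add0r; congr (_ + _).
  apply/polyP => i; rewrite coef0 coef_take_poly; case: ltnP => // lt_im.
  by apply/esym/eqP; apply: contraTT lt_im; rewrite -leqNgt => /m_min.
have qP : is_prob_poly (drop_poly m (val p)).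
  apply/is_prob_polyP; split=> [i|]; first by rewrite coef_drop_poly prob_poly_ge0.
  by have := prob_poly_horner1 p; rewrite -{1}pE hornerM hornerXn expr1n mul1r.
exists m, (ProbPoly qP); split; last by apply: val_inj; rewrite /= pE.
by rewrite /= coef_drop_poly add0n lt_def pm_neq0 prob_poly_ge0.
Qed.

(** The scalar [l] may depend on [p], whereas [c] does not. The value of [l] can stay implicit,
    since the value 1 at 1 determines it. *)
Lemma prob_map_tilting :
  exists2 c, 0 < c & forall p, exists2 l, 0 < l &
    forall k, (val (Phi p))`_k = l * c ^+ k * (val p)`_k.
Proof.
have [c c_gt0 cP] := supp_morph_coef unscaled_supp_morphism.
exists c => // p; have [m [q [q0_gt0 ->]]] := prob_poly_factorXn p.
pose Q := ((val q)`_0)^-1 *: val q.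
have nQ : normalized Q.
  split=> [i|]; last by rewrite coefZ mulVf // gt_eqF.
  by rewrite coefZ mulr_ge0 ?invr_ge0 ?prob_poly_ge0.
have QE : rescale Q = q.
  apply: val_inj; rewrite val_rescale // hornerZ prob_poly_horner1 mulr1 invrK.
  by rewrite scalerA mulfV ?scale1r // gt_eqF.
have Pq0_gt0 : 0 < (val (Phi q))`_0 by apply/Phi_supp.
pose a := (val (Phi (prob_Xn R m)))`_m.
have a_gt0 : 0 < a by apply/Phi_supp; rewrite /= coefXn eqxx ltr01.
(* Support preservation forces the image of a monomial to be a monomial of the same degree. *)
have PXnE : val (Phi (prob_Xn R m)) = a *: 'X^m.
  apply/polyP => i; rewrite coefZ coefXn; case: eqP => [->|/eqP ne_im].
    by rewrite mulr1.
  by rewrite mulr0; apply/supp_preserving_eq0; rewrite /= coefXn (negPf ne_im).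
(* The first three factors undo the normalizations; [c^m] compensates for the shift by [X^m], which
   turns [c^k] into [c^(k-m)]. *)
exists (a * (val (Phi q))`_0 * ((val q)`_0)^-1 / c ^+ m).
  by rewrite !mulr_gt0 ?invr_gt0 ?exprn_gt0.
move=> k; rewrite Phi_mul /= [prob_poly_val (Phi (prob_Xn R m))]PXnE -scalerAl coefZ.
rewrite !coefXnM; case: ltnP => [|le_mk]; first by rewrite !mulr0.
have := cP Q (k - m)%N nQ; rewrite /unscaled QE !coefZ => E.
have -> : (val (Phi q))`_(k - m) =
    (val (Phi q))`_0 * (c ^+ (k - m) * (((val q)`_0)^-1 * (val q)`_(k - m))).
  by rewrite -E mulrA mulfV ?mul1r // gt_eqF.
rewrite expfB_cond ?gt_eqF //; first by rewrite !mulrA; ring.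
Qed.

End Tilting.

(** * Recovering the map from one image *)

Lemma count_ge2_nth (T : Type) (x0 : T) (a : pred T) (s : seq T) :
  (2 <= count a s)%N -> exists i j, [/\ (i < j)%N, a (nth x0 s i) & a (nth x0 s j)].
Proof.
elim: s => //= x s IHs; case: (boolP (a x)) => [ax|_].
  rewrite add1n ltnS -has_count => /(has_nthP x0)[j _ aj].
  by exists 0%N, j.+1.
by rewrite add0n => /IHs[i [j [lt_ij ai aj]]]; exists i.+1, j.+1.
Qed.

Theorem corollary1p1 (R : realType) (Phi Phi' : prob_poly R -> prob_poly R)
    (Phi_supp : support_preserving Phi) (Phi_mul : multiplicative_map Phi)
    (Phi'_supp : support_preserving Phi') (Phi'_mul : multiplicative_map Phi')
    (p : prob_poly R) (p_terms : (2 <= nb_terms p)%N) :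
  Phi p = Phi' p -> Phi = Phi'.
Proof.
move=> eq_p.
have [c c_gt0 cP] := prob_map_tilting Phi_supp Phi_mul.
have [c' c'_gt0 c'P] := prob_map_tilting Phi'_supp Phi'_mul.
have eq_c : c = c'.
  have [l l_gt0 lP] := cP p; have [l' l'_gt0 l'P] := c'P p.
  have eqk k : (val p)`_k != 0 -> l * c ^+ k = l' * c' ^+ k.
    by move=> pk_neq0; apply: (mulIf pk_neq0); rewrite -lP -l'P eq_p.
  (* Dividing the equations at two support degrees [i < j] eliminates [l] and [l'] and leaves
     [c^(j-i) = c'^(j-i)]; positivity gives [c = c']. *)
  have [i [j [lt_ij /= /eqk eqi /eqk]]] := count_ge2_nth 0 p_terms.
  rewrite -(subnK (ltnW lt_ij)) addnC !exprD !mulrA -eqi.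
  have lci_neq0 : l * c ^+ i != 0 by rewrite gt_eqF // mulr_gt0 ?exprn_gt0.
  move/(mulfI lci_neq0)/eqP.
  by rewrite eqrXn2 ?subn_gt0 ?ltW // => /eqP.
apply: funext => q; apply: val_inj.
have [l l_gt0 lP] := cP q; have [l' l'_gt0 l'P] := c'P q.
(* The two images of [q] are proportional, and both take the value 1 at 1. *)
have E : val (Phi q) = (l / l') *: val (Phi' q).
  by apply/polyP => k; rewrite coefZ lP l'P -eq_c !mulrA divfK // gt_eqF.
have := prob_poly_horner1 (Phi q).
by rewrite E hornerZ prob_poly_horner1 mulr1 => ->; rewrite scale1r.
Qed.
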